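(* Let $\mathbf{A}\in\mathbb{R}^{m\times n}$, $\mathbf{b}\in\mathbb{R}^m$, let $p<\infty$ be the exponent of an $\ell_p$ norm and let $\epsilon$ be a prescribed constant. Let $\mathbf{x}_{SMMAE}\in\mathbb{R}_{\max}^n$ be defined as $$\mathbf{x}_{SMMAE}=\mathbf{x}_{p,\epsilon}+\frac{\|\mathbf{b}-\mathbf{A}\boxplus\mathbf{x}_{p,\epsilon}\|_\infty}{2}$$ (the scalar being added to every entry), where $\mathbf{x}_{p,\epsilon}$ is a solution, with fixed $(p,\epsilon)$, of the problem $$\arg\min_{\mathbf{x}\in\mathbb{R}_{\max}^n}|\mathrm{supp}(\mathbf{x})|\quad\text{s.t.}\quad \|\mathbf{b}-\mathbf{A}\boxplus\mathbf{x}\|_p^p\le\epsilon,\quad \mathbf{A}\boxplus\mathbf{x}\le\mathbf{b}.$$ Then for all $\mathbf{z}\in\mathbb{R}_{\max}^n$ with $\mathrm{supp}(\mathbf{z})=\mathrm{supp}(\mathbf{x}_{p,\epsilon})$, it holds $$\|\mathbf{b}-\mathbf{A}\boxplus\mathbf{z}\|_\infty\ge\|\mathbf{b}-\mathbf{A}\boxplus\mathbf{x}_{SMMAE}\|_\infty=\frac{\|\mathbf{b}-\mathbf{A}\boxplus\mathbf{x}_{p,\epsilon}\|_\infty}{2},$$ and, also, $$\|\mathbf{b}-\mathbf{A}\boxplus\mathbf{x}_{SMMAE}\|_\infty\le\frac{\sqrt[p]{\epsilon}}{2}.$$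
   Context: $\mathbb{R}_{\max}=\mathbb{R}\cup\{-\infty\}$. For $\mathbf{x}\in\mathbb{R}_{\max}^n$, $[\mathbf{A}\boxplus\mathbf{x}]_i=\max_{1\le j\le n}(A_{ij}+x_j)$ for $i=1,\dots,m$, and $\mathrm{supp}(\mathbf{x})=\{j:x_j\neq-\infty\}$. Inequalities between vectors are componentwise. $\|\mathbf{v}\|_p^p=\sum_i|v_i|^p$ and $\|\mathbf{v}\|_\infty=\max_i|v_i|$, with value $+\infty$ if some entry is infinite. Adding a real number to $-\infty$ gives $-\infty$.
   Formalization: The lower bound over z is proved only for solutions x_{p,ε} maximal in the componentwise order among all solutions; for arbitrary solutions it fails (A=b=0, m=n=1, p=ε=1, x=-1, z=0). The equality and the bound by ε^{1/p}/2 hold for every solution. *)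

(* Defs.v *)
From HB Require Import structures.
From mathcomp Require Import all_boot all_order all_algebra.
From mathcomp Require Import all_classical all_reals all_analysis.
Set Implicit Arguments.
Unset Strict Implicit.
Unset Printing Implicit Defensive.
Import Order.TTheory GRing.Theory Num.Theory.
Local Open Scope ring_scope.
Local Open Scope ereal_scope.

(* R_max = R u {-oo} is carried by \bar R, whose addition satisfies
   a%:E + -oo = -oo; [in_Rmax] excludes the value +oo. *)
Definition in_Rmax (R : realType) (n : nat) (x : 'I_n -> \bar R) : Prop :=
  forall j, x j != +oo.

Definition supp (R : realType) (n : nat) (x : 'I_n -> \bar R) : {set 'I_n} :=
  [set j | x j != -oo]%SET.

Definition maxplus_mul (R : realType) (m n : nat) (A : 'M[R]_(m, n))
    (x : 'I_n -> \bar R) : 'I_m -> \bar R :=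
  fun i => \big[maxe/-oo]_(j < n) ((A i j)%:E + x j).

(* b - A [+] x; an entry is +oo when that entry of A [+] x is -oo. *)
Definition residual (R : realType) (m n : nat) (A : 'M[R]_(m, n))
    (b : 'cV[R]_m) (x : 'I_n -> \bar R) : 'I_m -> \bar R :=
  fun i => (b i ord0)%:E - maxplus_mul A x i.

(* ||v||_p^p, without the p-th root. *)
Definition lp_norm_pow (R : realType) (m : nat) (p : R)
    (v : 'I_m -> \bar R) : \bar R :=
  \sum_(i < m) `|v i| `^ p.

Definition linf_norm (R : realType) (m : nat) (v : 'I_m -> \bar R) : \bar R :=
  \big[maxe/0]_(i < m) `|v i|.

Definition feasible (R : realType) (m n : nat) (A : 'M[R]_(m, n))
    (b : 'cV[R]_m) (p eps : R) (x : 'I_n -> \bar R) : Prop :=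
  [/\ in_Rmax x,
      lp_norm_pow p (residual A b x) <= eps%:E
    & forall i, maxplus_mul A x i <= (b i ord0)%:E].

Definition sparse_solution (R : realType) (m n : nat) (A : 'M[R]_(m, n))
    (b : 'cV[R]_m) (p eps : R) (x : 'I_n -> \bar R) : Prop :=
  feasible A b p eps x /\
  forall y : 'I_n -> \bar R, feasible A b p eps y -> (#|supp x| <= #|supp y|)%N.

(* Minimizers are not unique, and the lower bound over all z with the same
   support fails for some of them: for m = n = 1, A = 0, b = 0, p = eps = 1, the
   minimizer x = -1 has smmae error 1/2, whereas z = 0 has error 0. It holds for
   the minimizers that are maximal in the componentwise order, i.e. (for m > 0)
   those whose finite entries are the principal ones,
   x_j = min_i (b_i - A_ij) on the support. *)
Definition maximal_sparse_solution (R : realType) (m n : nat)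
    (A : 'M[R]_(m, n)) (b : 'cV[R]_m) (p eps : R) (x : 'I_n -> \bar R) : Prop :=
  sparse_solution A b p eps x /\
  forall y : 'I_n -> \bar R, sparse_solution A b p eps y ->
    (forall j, x j <= y j) -> forall j, y j = x j.

Definition smmae (R : realType) (m n : nat) (A : 'M[R]_(m, n))
    (b : 'cV[R]_m) (x : 'I_n -> \bar R) : 'I_n -> \bar R :=
  fun j => x j + linf_norm (residual A b x) / 2%:E.

(* Main.v *)
Require Import Defs.
From HB Require Import structures.
From mathcomp Require Import all_boot all_order all_algebra.
From mathcomp Require Import all_classical all_reals all_analysis.
From mathcomp Require Import lra.
Set Implicit Arguments.
Unset Strict Implicit.
Unset Printing Implicit Defensive.
Import Order.TTheory GRing.Theory Num.Theory.
Local Open Scope ring_scope.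
Local Open Scope ereal_scope.

(** Write D for the sup norm of the residual r = b - A [+] x of a feasible x.
    Feasibility puts every r_i in [0, D], and adding the scalar D/2 to x
    subtracts D/2 from every r_i ([residualD]), which centres this interval
    at 0.  All entries are then at most D/2 in absolute value, and the entry
    where D is attained gives exactly D/2 ([linf_norm_smmae]).  The p-th
    power of each r_i is a term of the sum that the constraint bounds by eps,
    so D is at most eps to the power 1/p ([linf_norm_feasible]).

    For the optimality over z, let e be the error of z, assumed finite.
    Lowering z by e makes it a subsolution: A [+] (z - e) <= b.  A maximal
    sparse solution dominates every subsolution supported inside its own
    support ([maximal_sparse_solution_ge]), because its join with such a
    subsolution is again a sparse solution.  Hence z - e <= x, so by
    monotonicity b - A [+] x <= (b - A [+] z) + e <= 2e, that is, D/2 <= e. *)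

Lemma linf_norm_ge0 (R : realType) (m : nat) (v : 'I_m -> \bar R) :
  0 <= linf_norm v.
Proof. exact: bigmax_ge_id. Qed.

Lemma le_linf_norm (R : realType) (m : nat) (v : 'I_m -> \bar R) i :
  `|v i| <= linf_norm v.
Proof. exact: le_bigmax. Qed.

Lemma linf_norm_le (R : realType) (m : nat) (v : 'I_m -> \bar R) c :
  0 <= c -> (forall i, `|v i| <= c) -> linf_norm v <= c.
Proof. by move=> c0 vc; apply: bigmax_le. Qed.

(** The first alternative covers vectors without entries. *)
Lemma linf_norm_attained (R : realType) (m : nat) (v : 'I_m -> \bar R) :
  linf_norm v = 0 \/ exists i, linf_norm v = `|v i|.
Proof.
apply: (big_ind (fun t : \bar R => t = 0 \/ exists i, t = `|v i|)).
- by left.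
- by move=> s t hs ht; rewrite maxEle; case: ifP.
- by move=> i _; right; exists i.
Qed.

Lemma maxplus_mul_le (R : realType) (m n : nat) (A : 'M[R]_(m, n))
    (x y : 'I_n -> \bar R) i :
  (forall j, x j <= y j) -> maxplus_mul A x i <= maxplus_mul A y i.
Proof. by move=> xy; apply: le_bigmax2 => j _; exact: leeD2l. Qed.

Lemma maxplus_mulD (R : realType) (m n : nat) (A : 'M[R]_(m, n))
    (x : 'I_n -> \bar R) (c : R) i :
  maxplus_mul A (fun j => x j + c%:E) i = maxplus_mul A x i + c%:E.
Proof.
rewrite /maxplus_mul (big_morph (fun t => t + c%:E) (id1 := -oo) (op1 := maxe)).
- by apply: eq_bigr => j _; rewrite addeA.
- by move=> s t; rewrite adde_maxl.
- by [].
Qed.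

(** Max-plus linearity: the join is the addition of the semiring, so it makes
    joins of subsolutions of A [+] x <= b subsolutions. *)
Lemma maxplus_mul_max (R : realType) (m n : nat) (A : 'M[R]_(m, n))
    (x y : 'I_n -> \bar R) i :
  maxplus_mul A (fun j => maxe (x j) (y j)) i =
  maxe (maxplus_mul A x i) (maxplus_mul A y i).
Proof.
rewrite /maxplus_mul -bigmax_split.
by apply: eq_bigr => j _; rewrite adde_maxr.
Qed.

Lemma residualD (R : realType) (m n : nat) (A : 'M[R]_(m, n)) (b : 'cV[R]_m)
    (x : 'I_n -> \bar R) (c : R) i :
  residual A b (fun j => x j + c%:E) i = residual A b x i - c%:E.
Proof.
by rewrite /residual maxplus_mulD fin_num_oppeD// addeA.
Qed.

Lemma residual_ge0 (R : realType) (m n : nat) (A : 'M[R]_(m, n))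
    (b : 'cV[R]_m) (p eps : R) (x : 'I_n -> \bar R) i :
  feasible A b p eps x -> 0 <= residual A b x i.
Proof. by case=> _ _ /(_ i) h; rewrite sube_ge0// orbT. Qed.

(** Any single term of the sum of p-th powers is at most the whole sum.  In
    particular the residual of a feasible vector is finite. *)
Lemma linf_norm_feasible (R : realType) (m n : nat) (A : 'M[R]_(m, n))
    (b : 'cV[R]_m) (p eps : R) (x : 'I_n -> \bar R) :
  (1 <= p)%R -> feasible A b p eps x ->
  linf_norm (residual A b x) <= (eps `^ p^-1)%:E.
Proof.
move=> p1 [_ hp _]; have p0 : (0 < p)%R by exact: lt_le_trans p1.
apply: linf_norm_le => [|i]; first by rewrite lee_fin powR_ge0.
have hi : `|residual A b x i| `^ p <= eps%:E.
  apply: le_trans hp; rewrite /lp_norm_pow (bigD1 i)//= leeDl//.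
  by apply: sume_ge0 => j _; exact: poweR_ge0.
case: (`|residual A b x i|) (abse_ge0 (residual A b x i)) hi => [r| |]//.
- rewrite poweR_EFin !lee_fin => r0 hr.
  (* take p-th roots, writing r as (r^p)^(1/p) *)
  rewrite -[leLHS](powRr1 r0) -(mulfV (lt0r_neq0 p0)) powRrM.
  by apply: ge0_ler_powR; rewrite ?nnegrE ?invr_ge0 ?powR_ge0 ?(ltW p0)//;
    apply: le_trans hr; exact: powR_ge0.
- by rewrite poweRyr ?gt_eqF.
Qed.

Lemma inve2 (R : realType) : (2%:E : \bar R)^-1 = 2^-1%:E.
Proof. by rewrite inver pnatr_eq0. Qed.

(** The residual of a feasible vector lies in [0, D] and reaches D, so
    the shift by D/2 turns it into a residual in [-D/2, D/2] reaching D/2.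
    For m = 0 both sides vanish. *)
Lemma linf_norm_smmae (R : realType) (m n : nat) (A : 'M[R]_(m, n))
    (b : 'cV[R]_m) (p eps : R) (x : 'I_n -> \bar R) :
  (1 <= p)%R -> feasible A b p eps x ->
  linf_norm (residual A b (smmae A b x)) = linf_norm (residual A b x) / 2%:E.
Proof.
move=> p1 fx.
have r0 i := residual_ge0 i fx.
have rD i := le_linf_norm (residual A b x) i.
have att := linf_norm_attained (residual A b x).
rewrite /smmae.
case: (linf_norm _) (linf_norm_ge0 (residual A b x))
    (linf_norm_feasible p1 fx) rD att => [D||]// D0 _ rD att.
rewrite inve2 -EFinM lee_fin in D0 *.
apply/le_anti/andP; split.
- apply: linf_norm_le => [|i]; first by rewrite lee_fin; lra.
  rewrite residualD.
  case: (residual A b x i) (r0 i) (rD i) => [r||]//.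
  rewrite -EFinB !abse_EFin !lee_fin => r0i; rewrite ger0_norm// => rDi.
  by rewrite ler_norml; lra.
- case: att => [[->]|[i Di]]; first by rewrite mul0r linf_norm_ge0.
  (* the entry equal to D becomes D - D/2 = D/2 *)
  apply: le_trans (le_linf_norm _ i); rewrite residualD.
  have -> : residual A b x i = D%:E by rewrite Di gee0_abs.
  rewrite -EFinB abse_EFin lee_fin.
  by apply: le_trans (ler_norm _); lra.
Qed.

(** The join w of x and y has the support of x, and its residual lies between
    0 and that of x because both x and y satisfy A [+] _ <= b; so w is feasible
    and as sparse as x.  Maximality of x then forces w = x. *)
Lemma maximal_sparse_solution_ge (R : realType) (m n : nat) (A : 'M[R]_(m, n))
    (b : 'cV[R]_m) (p eps : R) (x y : 'I_n -> \bar R) :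
  (0 <= p)%R -> maximal_sparse_solution A b p eps x ->
  in_Rmax y -> supp y \subset supp x ->
  (forall i, maxplus_mul A y i <= (b i ord0)%:E) -> forall j, y j <= x j.
Proof.
move=> p0 [[fx minx] maxx] ypoo /fintype.subsetP yx yb j.
pose w j := maxe (x j) (y j).
have xw k : x k <= w k by rewrite le_max lexx.
have [xpoo xeps xb] := fx.
have fw : feasible A b p eps w.
  have wb i : maxplus_mul A w i <= (b i ord0)%:E.
    by rewrite maxplus_mul_max ge_max xb yb.
  split=> //.
  - by move=> k; rewrite /w maxEle; case: ifP.
  - apply: le_trans xeps; apply: lee_sum => i _.
    have rw0 : 0 <= residual A b w i by rewrite sube_ge0 ?wb ?orbT.
    have rwx : residual A b w i <= residual A b x i.
      by apply: leeB => //; exact: maxplus_mul_le.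
    have rx0 := le_trans rw0 rwx.
    by rewrite !gee0_abs//; apply: gt0_ler_poweR;
      rewrite ?in_itv/= ?andbT ?leey ?rw0 ?rx0.
have suppw : supp w = supp x.
  apply/setP => k; rewrite !inE; move: (yx k); rewrite !inE /w maxEle.
  case: ifP => // xy H; apply/idP/idP => // xk.
  by apply: contra_neq xk => yk; apply/eqP; rewrite -leeNy_eq -yk.
rewrite -(maxx w) ?le_max ?lexx ?orbT//.
by split=> // v fv; rewrite suppw; exact: minx.
Qed.

Theorem proposition5 (R : realType) (m n : nat) (A : 'M[R]_(m, n))
    (b : 'cV[R]_m) (p eps : R) (hp : (1 <= p)%R)
    (x : 'I_n -> \bar R) (hx : sparse_solution A b p eps x) :
  [/\ maximal_sparse_solution A b p eps x ->
      forall z : 'I_n -> \bar R, in_Rmax z -> supp z = supp x ->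
        linf_norm (residual A b (smmae A b x)) <= linf_norm (residual A b z),
      linf_norm (residual A b (smmae A b x)) =
        linf_norm (residual A b x) / 2%:E
    & linf_norm (residual A b (smmae A b x)) <= ((eps `^ p^-1) / 2)%R%:E].
Proof.
have [fx _] := hx; have sm := linf_norm_smmae hp fx.
have half (t c : \bar R) : t <= c -> t / 2%:E <= c / 2%:E.
  by move=> tc; rewrite inve2 lee_pmul2r// lte_fin invr_gt0.
split=> //; rewrite sm; last first.
  apply: (le_trans (half _ _ (linf_norm_feasible hp fx))).
  by rewrite inve2.
move=> mx z zpoo zx.
case: (linf_norm (residual A b z)) (linf_norm_ge0 (residual A b z))
    (le_linf_norm (residual A b z)) => [e||]// e0 ze; last exact: leey.
pose y j := z j + (- e)%:E.
have yx : forall j, y j <= x j.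
  apply: (maximal_sparse_solution_ge _ mx).
  - exact: le_trans hp.
  - by move=> j; rewrite /y; case: (z j) (zpoo j).
  - rewrite -zx; apply/fintype.subsetP => j; rewrite !inE /y.
    by case: (z j).
  (* A [+] z - e <= b; the error bound e rules out infinite entries of A [+] z *)
  - move=> i; rewrite maxplus_mulD; move: (ze i); rewrite /residual.
    case: (maxplus_mul A z i) => [t||]//=.
    by rewrite !lee_fin ler_norml; lra.
apply: (@le_trans _ _ ((e + e)%:E / 2%:E)).
  apply: half; apply: linf_norm_le => [|i].
    by move: e0; rewrite !lee_fin; lra.
  (* b - A [+] x <= b - A [+] (z - e) = (b - A [+] z) + e <= e + e *)
  rewrite gee0_abs; last exact: residual_ge0 fx.
  have := maxplus_mul_le A i yx; rewrite maxplus_mulD; move: (ze i).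
  rewrite /residual; case: (maxplus_mul A z i) => [t||]//=.
  case: (maxplus_mul A x i) => [s||]//=; last by rewrite leNye.
  by rewrite !lee_fin ler_norml; lra.
by rewrite inve2 -EFinM lee_fin; lra.
Qed.
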